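(* Assume that $x_s\ge0$ is constant in time, together with conditions (F), (G), (H) of the context. Given $V_{E0}$, $x_s$, $x_l$ and $\alpha_{cI}$, the stationary potential $V_T(\infty;\varphi)$ of the system in the context depends monotonically on the function $\varphi$, but in the opposite sense: if $\varphi$ and $\widehat\varphi$ are two admissible functions with $\varphi\ge\widehat\varphi$ pointwise, then $V_T(\infty;\varphi)\le V_T(\infty;\widehat\varphi)$.
   Context: $\mathbb R_+=[0,\infty)$. The system is $$\begin{cases}\tau_E\dot V_E=-(V_E-V_{E0})+g_{sE}(x_s),\\ \tau_I\dot V_I=-(V_I-V_{I0})+g_{lI}(x_l)+G_T(V_T)+\alpha_{cI}\,g_{cI}(\psi(x_l)),\\ \tau_T\dot V_T=-(V_T-V_{T0})+g_{sT}(x_s)+g_{lT}(x_l)+G_E(V_E)-G_I(V_I),\end{cases}$$ with constants $\tau_E,\tau_I,\tau_T>0$, $V_{E0},V_{I0},V_{T0}\in\mathbb R$, $x_l\ge0$, $\alpha_{cI}\in[-1,1]$, and $$G_T(V)=g_{dI}(\varphi(f_T(V))),\quad G_E(V)=g_{ET}(f_E(V)),\quad G_I(V)=g_{IT}(f_I(V)).$$ Its unique stationary state (zero of the right-hand side) is $(V_E(\infty),V_I(\infty),V_T(\infty))$; $V_T(\infty;\varphi)$ denotes its $T$-component as a function of $\varphi$, all other data being fixed. Conditions: (F) For $k\in\{E,I,T\}$, $f_k\in C(\mathbb R,\mathbb R_+)\cap C^1((V_{uk},\infty),\mathbb R_+)$, $f_k(s)=0$ for $s<V_{uk}$ for some threshold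 $V_{uk}\in\mathbb R$, and $f_k$ is strictly increasing for $s>V_{uk}$. (G) For $jk\in\{sE,sT,lI,lT,dI,cI,ET,IT\}$, $g_{jk}\in C^1(\mathbb R_+,\mathbb R_+)$ is bounded and strictly increasing with $g_{jk}(0)=0$. (H) $\varphi,\psi\in C^1(\mathbb R_+,\mathbb R_+)$ are strictly increasing with $\varphi(0)=\psi(0)=0$ (''admissible'' $\varphi$ means satisfying (H)). *)

(* Defs.v *)
From mathcomp Require Import all_boot all_order all_algebra.
From mathcomp Require Import all_classical all_reals all_analysis.
Import Order.TTheory GRing.Theory Num.Theory numFieldNormedType.Exports.

Set Implicit Arguments.
Unset Strict Implicit.
Unset Printing Implicit Defensive.

Local Open Scope classical_set_scope.
Local Open Scope ring_scope.

Inductive population := popE | popI | popT.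

Inductive synapse := sE | sT | lI | lT | dI | cI | ET | IT.

(* Functions on a subset of R are encoded as total functions, of which only
   the values on that subset matter. *)

(* C^1 on A, with difference quotients restricted to A: at the endpoint of
   [0, +oo[ the derivative is thus the right derivative. *)
Definition C1_on (R : realType) (A : set R) (h : R -> R) : Prop :=
  exists2 dh : R -> R, {within A, continuous dh} &
    forall x, A x ->
      (h y - h x) / (y - x) @[y --> within A x^'] --> dh x.

Definition condition_F (R : realType) (f : R -> R) : Prop :=
  exists u : R,
    [/\ continuous f /\ forall s, 0 <= f s,
        C1_on `]u, +oo[ f,
        forall s, s < u -> f s = 0
      & {in `]u, +oo[ &, {homo f : s t / s < t}}].

Definition condition_G (R : realType) (g : R -> R) : Prop :=
  [/\ C1_on `[0, +oo[ g /\ forall x, 0 <= x -> 0 <= g x,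
      [bounded g x | x in `[0, +oo[%classic],
      {in `[0, +oo[ &, {homo g : x y / x < y}}
    & g 0 = 0].

Definition condition_H (R : realType) (phi : R -> R) : Prop :=
  [/\ C1_on `[0, +oo[ phi /\ forall x, 0 <= x -> 0 <= phi x,
      {in `[0, +oo[ &, {homo phi : x y / x < y}}
    & phi 0 = 0].

(* All the data of the system except x_s and phi. *)
Record circuit (R : realType) := Circuit {
  tau : population -> R;
  V0 : population -> R;
  x_l : R;
  alpha_cI : R;
  fk : population -> R -> R;
  gjk : synapse -> R -> R;
  psi : R -> R
}.

Record standing_assumptions (R : realType) (c : circuit R) : Prop := {
  tau_gt0 : forall k, 0 < tau c k;
  x_l_ge0 : 0 <= x_l c;
  alpha_cI_bounds : -1 <= alpha_cI c <= 1;
  f_condition_F : forall k, condition_F (fk c k);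
  g_condition_G : forall jk, condition_G (gjk c jk);
  psi_condition_H : condition_H (psi c)
}.

Definition G_T (R : realType) (c : circuit R) (phi : R -> R) (v : R) : R :=
  gjk c dI (phi (fk c popT v)).

Definition G_E (R : realType) (c : circuit R) (v : R) : R :=
  gjk c ET (fk c popE v).

Definition G_I (R : realType) (c : circuit R) (v : R) : R :=
  gjk c IT (fk c popI v).

(* The system is  tau c k * V_k' = rhs c x_s phi V k  for each k; the time
   constants are on the left-hand side. *)
Definition rhs (R : realType) (c : circuit R) (x_s : R) (phi : R -> R)
    (V : population -> R) (k : population) : R :=
  match k with
  | popE => - (V popE - V0 c popE) + gjk c sE x_s
  | popI => - (V popI - V0 c popI) + gjk c lI (x_l c) + G_T c phi (V popT)
            + alpha_cI c * gjk c cI (psi c (x_l c))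
  | popT => - (V popT - V0 c popT) + gjk c sT x_s + gjk c lT (x_l c)
            + G_E c (V popE) - G_I c (V popI)
  end.

Definition stationary_state (R : realType) (c : circuit R) (x_s : R)
    (phi : R -> R) (V : population -> R) : Prop :=
  forall k, rhs c x_s phi V k = 0.

(* Main.v *)
Require Import Defs.
From mathcomp Require Import all_boot all_order all_algebra.
From mathcomp Require Import all_classical all_reals all_analysis.
From mathcomp Require Import lra.
Import Order.TTheory GRing.Theory Num.Theory numFieldNormedType.Exports.
Local Open Scope ring_scope.

(** The circuit contains a negative feedback loop: [T] excites [I] through
    [G_T], which increases with [phi], and [I] inhibits [T] through [G_I].
    At stationarity [V popE] is determined by its own resting value and [x_s],
    so it is the same for both functions, and [V popT] is a constant minus [G_I (V popI)].  If
    [V popT] were larger for the larger function [phi], then [I] would receive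
    at least as much excitation as with [phihat], since both the argument and
    the function have grown; hence [V popI], and with it the inhibition of
    [T], would be at least as large, which forces [V popT] to be no larger: a
    contradiction.  The comparison of the two excitations is [G_T_le]; the firing
    rates are nondecreasing across their thresholds by
    [condition_F_nondecreasing]. *)

Lemma homo_le_of_lt_nneg (R : realType) (h : R -> R) :
  {in `[0, +oo[ &, {homo h : x y / x < y}} ->
  forall x y, 0 <= x -> x <= y -> h x <= h y.
Proof.
move=> /ltW_homo_in hh x y x0 xy.
by apply: hh; rewrite ?in_itv /= ?andbT // (le_trans x0).
Qed.

(** Condition (F) says nothing directly about the value at the threshold [u];
    it vanishes because [f] is continuous and is zero to the left of [u].
    This is what glues the two monotone branches together. *)
Lemma condition_F_nondecreasing (R : realType) (f : R -> R) :
  condition_F f -> {homo f : s t / s <= t}.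
Proof.
move=> [u [[f_cont f_ge0] _ f_eq0 f_incr]] s t st.
have fu0 : f u = 0.
  have cvg_fu : (f x @[x --> u^'-] --> f u)%classic.
    exact/cvg_at_left_filter/f_cont.
  have cvg_0 : (f x @[x --> u^'-] --> (0 : R))%classic.
    apply: cvg_near_cst; near=> x.
    by apply: f_eq0; near: x; exact: nbhs_left_lt.
  exact: cvg_unique cvg_fu cvg_0.
case: (ltgtP s u) => [su|us|->]; first by rewrite f_eq0.
  by apply: (ltW_homo_in f_incr); rewrite ?in_itv /= ?andbT // (lt_le_trans us).
by rewrite fu0.
Unshelve. all: by end_near. Qed.

Lemma condition_F_ge0 (R : realType) (f : R -> R) :
  condition_F f -> forall s, 0 <= f s.
Proof. by move=> [u [[]]]. Qed.

Section Responses.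
Context {R : realType} (c : circuit R) (hc : standing_assumptions c).

Let f_ge0 k s : 0 <= fk c k s.
Proof. exact: condition_F_ge0 _ _ (f_condition_F hc k) _. Qed.

Let f_nd k s t : s <= t -> fk c k s <= fk c k t.
Proof. exact: condition_F_nondecreasing (f_condition_F hc k) _ _. Qed.

Let g_nd jk x y : 0 <= x -> x <= y -> gjk c jk x <= gjk c jk y.
Proof.
by case: (g_condition_G hc jk) => _ _ g_incr _; exact: homo_le_of_lt_nneg.
Qed.

Lemma G_I_nondecreasing : {homo G_I c : v w / v <= w}.
Proof. by move=> v w vw; apply: g_nd => //; exact: f_nd. Qed.

(** The drive from [T] to [I] grows with the potential and the coupling
    function at once; the monotonicity of the larger function [phi] moves the
    potential, and the comparison is then made at the same rate. *)
Lemma G_T_le (phi phihat : R -> R) (v w : R) :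
  condition_H phi -> condition_H phihat ->
  (forall x, 0 <= x -> phihat x <= phi x) ->
  v <= w -> G_T c phihat v <= G_T c phi w.
Proof.
move=> [_ phi_incr _] [[_ phihat_ge0] _ _] hle vw.
apply: g_nd; first exact: phihat_ge0.
apply: le_trans (hle _ (f_ge0 _ _)) _.
by apply: (homo_le_of_lt_nneg _ _ phi_incr) => //; exact: f_nd.
Qed.

End Responses.

Theorem proposition2 (R : realType) (c : circuit R) (x_s : R)
    (phi phihat : R -> R) (V Vhat : population -> R)
    (hc : standing_assumptions c)
    (hx_s : 0 <= x_s)
    (hphi : condition_H phi)
    (hphihat : condition_H phihat)
    (hle : forall x, 0 <= x -> phihat x <= phi x)
    (hV : stationary_state c x_s phi V)
    (hVhat : stationary_state c x_s phihat Vhat) :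
  V popT <= Vhat popT.
Proof.
rewrite leNgt; apply/negP => VT_lt.
have drive_le : G_T c phihat (Vhat popT) <= G_T c phi (V popT).
  exact/G_T_le/ltW.
have VE_eq : V popE = Vhat popE.
  by move: (hV popE) (hVhat popE); rewrite /rhs; lra.
have VI_le : Vhat popI <= V popI.
  by move: (hV popI) (hVhat popI); rewrite /rhs; lra.
have inhib_le := G_I_nondecreasing _ hc _ _ VI_le.
by move: (hV popT) (hVhat popT); rewrite /rhs VE_eq; lra.
Qed.
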